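(* Let $F$ be a subset of $E(K_{n,n})$. Then there exists a perfect matching $N$ of $K_{n,n}$ such that $|N\cap F|\ge \left\lfloor \frac{|F|}{n}\right\rfloor-1$ and $|N\setminus F|\ge \left\lfloor\frac{|E(K_{n,n})\setminus F|}{n}\right\rfloor-1$.
   Context: $K_{n,n}$ is the complete bipartite graph with $n$ vertices on each side ($n\ge 1$), and $E(K_{n,n})$ is its edge set. *)

(* Defs.v *)
From mathcomp Require Import all_boot.

Set Implicit Arguments.
Unset Strict Implicit.
Unset Printing Implicit Defensive.

(* A finite simple graph is given by a symmetric irreflexive adjacency
   relation on its finite type of vertices; its edges are unordered pairs
   [set x; y] of adjacent vertices. *)
Definition edge_set (V : finType) (e : rel V) : {set {set V}} :=
  [set [set x; y] | x in V, y in e x].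

Definition perfect_matching (V : finType) (e : rel V) (M : {set {set V}}) :=
  (M \subset edge_set e) /\ forall v : V, #|[set f in M | v \in f]| = 1.

Definition Knn (n : nat) : rel ('I_n + 'I_n)%type :=
  fun u v => match u, v with
             | inl _, inr _ | inr _, inl _ => true
             | _, _ => false
             end.

Lemma Knn_sym n : symmetric (@Knn n).
Proof. by case=> ? [] ?. Qed.

Lemma Knn_irr n : irreflexive (@Knn n).
Proof. by case. Qed.

(* Main.v *)
Require Import Defs.
From mathcomp Require Import all_boot.
From mathcomp Require Import fingroup perm ssralg zmodp zify.

(** A perfect matching of K_{n,n} is the graph of a permutation [s] of the [n]
indices, and a set of edges is a set [A] of cells of the [n] by [n] board;
[hits A s] counts the cells of the graph of [s] that lie in [A].  The [n] cyclic
shifts partition the board, so the average of [hits A] over them is [#|A| / n]: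
some shift has many hits in [A], and likewise some shift has many hits in the
complement of [A] ([exists_many_hits]).  To find one permutation that does both
jobs, move from permutation to permutation by transpositions.  Each of them
changes only two cells of the graph, hence changes [hits A] by at most 2
([hits_tperm]).  Suppose that every permutation fails one of the two bounds.
Failing the bound for [A] means fewer than [q - 1] hits, and failing the bound
for the complement means more than [q + 1] hits, where [q] is the integer part
of [#|A| / n].  No step of size 2 leaps over this gap, so failing the first
bound is inherited along transpositions, which generate all permutations
([tperm_closed_all]).  But one of the shifts fails only the second bound, and
another fails only the first: a contradiction. *)

Set Implicit Arguments.
Unset Strict Implicit.
Unset Printing Implicit Defensive.

Definition hits (n : nat) (A : {set 'I_n * 'I_n}) (s : 'S_n) : nat :=
  #|[set i | (i, s i) \in A]|.

Lemma hitsC (n : nat) (A : {set 'I_n * 'I_n}) (s : 'S_n) :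
  hits A s + hits (~: A) s = n.
Proof.
rewrite /hits -[RHS]card_ord -(cardsC [set i | (i, s i) \in A]).
by congr (_ + #|pred_of_set _|); apply/setP => i; rewrite !inE.
Qed.

(** The two graphs differ only in rows [i] and [j], and each of these rows holds
a single cell of either graph. *)
Lemma hits_tperm (n : nat) (A : {set 'I_n * 'I_n}) (s : 'S_n) (i j : 'I_n) :
  hits A (tperm i j * s) <= hits A s + 2.
Proof.
have sub : [set k | (k, (tperm i j * s)%g k) \in A]
    \subset [set k | (k, s k) \in A] :|: [set i; j].
  apply/subsetP => k; rewrite !inE permM.
  by case: tpermP => [->|->|_ _ ->] //; rewrite eqxx ?orbT.
apply: leq_trans (subset_leq_card sub) _.
apply: leq_trans (leq_card_setU _ _) _.
by rewrite leq_add2l cards2; case: (_ != _).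
Qed.

(** Transpositions generate the symmetric group, so its Cayley graph with
respect to them is connected. *)
Lemma tperm_closed_all (T : finType) (P : pred {perm T}) (s t : {perm T}) :
  (forall u x y, P u -> P (tperm x y * u)%g) -> P s -> P t.
Proof.
move=> closedP Ps; rewrite -(mulgKV s t).
have [ts -> _] := prod_tpermP (t * s^-1)%g.
elim: ts => [|[x y] ts IHts]; first by rewrite big_nil mul1g.
by rewrite big_cons -mulgA; apply: closedP.
Qed.

(** The graphs of the cyclic shifts partition the board, so the number of hits
averages to [#|A| / n] over them. *)
Lemma exists_many_hits (n : nat) (A : {set 'I_n * 'I_n}) :
  exists s : 'S_n, #|A| %/ n <= hits A s.
Proof.
case: n A => [|n] A; first by exists 1%g; rewrite divn0.
pose shift (k : 'I_n.+1) : 'S_n.+1 := perm (@GRing.addrI _ k).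
have sum_hits : \sum_k hits A (shift k) = #|A|.
  rewrite /hits; under eq_bigr => k _ do rewrite cardsE -sum1_card big_mkcond.
  rewrite exchange_big -[RHS]sum1_card [RHS]big_mkcond /=.
  rewrite (eq_bigr (fun p => if (p.1, p.2) \in A then 1 else 0)); last by case.
  rewrite -(pair_bigA _ (fun i j => if (i, j) \in A then 1 else 0)) /=.
  apply: eq_bigr => i _; rewrite [RHS](reindex_inj (@GRing.addIr _ i)) /=.
  by apply: eq_bigr => k _; rewrite unfold_in /= permE.
have [/existsP[k le_k]|/existsPn few] :=
  boolP [exists k, #|A| %/ n.+1 <= hits A (shift k)]; first by exists (shift k).
have : \sum_k (hits A (shift k)).+1 <= \sum_(k < n.+1) (#|A| %/ n.+1).
  by apply: leq_sum => k _; rewrite ltnNge few.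
rewrite sum_nat_const card_ord mulnC.
under eq_bigr => k _ do rewrite -addn1.
rewrite big_split /= sum_hits sum_nat_const card_ord.
by have := leq_divM #|A| n.+1; lia.
Qed.

(** A permutation failing both bounds is impossible by the choice of quotients;
if every permutation failed one of them, the size 2 of a step would be too small
to pass from one kind of failure to the other. *)
Lemma exists_balanced_hits (n : nat) (n_gt0 : 0 < n) (A : {set 'I_n * 'I_n}) :
  exists s : 'S_n,
    #|A| %/ n - 1 <= hits A s /\ #|~: A| %/ n - 1 <= hits (~: A) s.
Proof.
have sum_q : #|A| %/ n + #|~: A| %/ n <= n.
  rewrite -(leq_pmul2r n_gt0) mulnDl.
  have := cardsC A; rewrite card_prod card_ord => <-.
  by rewrite leq_add // leq_divM.
have [s many_s] := exists_many_hits A.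
have [t many_t] := exists_many_hits (~: A).
move: (#|A| %/ n) (#|~: A| %/ n) sum_q many_s many_t => q q' sum_q many_s many_t.
have [/existsP[u /andP[]]|/existsPn bad] :=
  boolP [exists u : 'S_n, (q - 1 <= hits A u) && (q' - 1 <= hits (~: A) u)].
  by exists u.
pose few (u : 'S_n) := hits A u < q - 1.
have few_tperm u i j : few u -> few (tperm i j * u)%g.
  (* From at most [q - 2] hits one reaches at most [q], while failing only the
     second bound takes at least [n - q' + 2 >= q + 2] hits. *)
  move: (hits_tperm A u i j) (hitsC A (tperm i j * u)%g) (bad (tperm i j * u)%g).
  by rewrite /few; move: (hits _ (_ * u)%g) (hits _ (_ * u)%g); lia.
have few_t : few t by rewrite /few; have := bad t; lia.
have := tperm_closed_all s few_tperm few_t.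
by rewrite /few; lia.
Qed.

Definition cell_edge (n : nat) (p : 'I_n * 'I_n) : {set 'I_n + 'I_n} :=
  [set inl p.1; inr p.2].

Lemma cell_edge_inj (n : nat) : injective (@cell_edge n).
Proof.
move=> [i j] [i' j'] /setP eq_e.
by have := eq_e (inl i); have := eq_e (inr j); rewrite !inE !eqxx /= orbF
  => /esym/eqP[->] /esym/eqP[->].
Qed.

Lemma edge_set_Knn (n : nat) : edge_set (@Knn n) = @cell_edge n @: setT.
Proof.
apply/setP => e; apply/imset2P/imsetP => [[[i|i] [j|j] _ //= _ ->]|[[i j] _ ->]].
- by exists (i, j).
- by exists (j, i); rewrite // /cell_edge setUC.
- by exists (inl i) (inr j).
Qed.

Definition perm_matching (n : nat) (s : 'S_n) : {set {set 'I_n + 'I_n}} :=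
  [set cell_edge (i, s i) | i in 'I_n].

Lemma mem_perm_matching (n : nat) (s : 'S_n) (i : 'I_n) :
  cell_edge (i, s i) \in perm_matching s.
Proof. by apply/imsetP; exists i. Qed.

Lemma perm_matchingP (n : nat) (s : 'S_n) :
  perfect_matching (@Knn n) (perm_matching s).
Proof.
split.
  rewrite edge_set_Knn; apply/subsetP => _ /imsetP[i _ ->].
  exact: imset_f.
have cover_by v k : (forall i, (v \in cell_edge (i, s i)) = (i == k)) ->
    #|[set f in perm_matching s | v \in f]| = 1.
  move=> v_in; apply/eqP/cards1P; exists (cell_edge (k, s k)); apply/setP => f.
  rewrite !inE; apply/andP/eqP => [[/imsetP[i _ ->]]|->].
    by rewrite v_in => /eqP->.
  by rewrite mem_perm_matching v_in.
case=> [i|j]; [apply: (cover_by _ i)|apply: (cover_by _ (s^-1 j)%g)] => k.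
  by rewrite !inE orbF eq_sym.
by rewrite !inE /= -(inj_eq (@perm_inj _ s) k) permKV eq_sym.
Qed.

Lemma card_perm_matchingI (n : nat) (s : 'S_n) (F : {set {set 'I_n + 'I_n}}) :
  #|perm_matching s :&: F| = hits (@cell_edge n @^-1: F) s.
Proof.
rewrite /hits -(card_imset _ (f := fun i => cell_edge (i, s i))); last first.
  by move=> i j /cell_edge_inj[].
congr #|pred_of_set _|; apply/setP => f; rewrite inE.
apply/andP/imsetP => [[/imsetP[i _ ->] Fi]|[i]]; first by exists i; rewrite ?inE.
by rewrite !inE => Fi ->; rewrite mem_perm_matching.
Qed.

Lemma card_edges_cells (n : nat) (F : {set {set 'I_n + 'I_n}}) :
  #|edge_set (@Knn n) :&: F| = #|@cell_edge n @^-1: F|.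
Proof.
rewrite edge_set_Knn -(card_imset (mem (@cell_edge n @^-1: F)) (@cell_edge_inj n)).
congr #|pred_of_set _|; apply/setP => f; rewrite inE.
apply/andP/imsetP => [[/imsetP[p _ ->] Fp]|[p]]; first by exists p; rewrite ?inE.
by rewrite !inE => Fp ->; rewrite imset_f.
Qed.

Theorem theorem5p1 (n : nat) (n_gt0 : 0 < n) (F : {set {set 'I_n + 'I_n}})
    (FE : F \subset edge_set (@Knn n)) :
  exists N : {set {set 'I_n + 'I_n}},
    [/\ perfect_matching (@Knn n) N,
        #|F| %/ n - 1 <= #|N :&: F| &
        #|edge_set (@Knn n) :\: F| %/ n - 1 <= #|N :\: F|].
Proof.
have [s [hitsF hitsCF]] := exists_balanced_hits n_gt0 (@cell_edge n @^-1: F).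
exists (perm_matching s); split; first exact: perm_matchingP.
  by rewrite card_perm_matchingI -{1}(setIidPr FE) card_edges_cells.
by rewrite !setDE card_edges_cells card_perm_matchingI preimsetC.
Qed.
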